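(* Suppose the family $\mathcal{F}=\{\mathbb{Z}_q^\ell: q\text{ a prime power},\ \ell\ge1\}$ achieves $\omega=2$ via STPP constructions. Then there exist constants $c>0$ and $C>0$ such that $\mathrm{val}(\mathbb{Z}_n)\ge C n^{1+c}$ for all positive integers $n$.
   Context: In an abelian group written additively, subsets $S,T,U$ satisfy the TPP if $(s-s')+(t-t')+(u-u')=0$ with $s,s'\in S,t,t'\in T,u,u'\in U$ implies $s=s',t=t',u=u'$; triples $(S_i,T_i,U_i)_{i=1}^k$ satisfy the STPP if each satisfies the TPP and whenever $x\in S_i-T_i$, $y\in T_j-U_j$, $z\in U_l-S_l$ with $x+y+z=0$, then $i=j=l$. A family $\mathcal{F}$ of finite abelian groups achieves $\omega=2$ via STPP constructions if for every $\delta>0$ there exist $G\in\mathcal{F}$ and an STPP $(S_i,T_i,U_i)_{i=1}^k$ in $G$ with $\sum_i(|S_i||T_i||U_i|)^{(2+\delta)/3}>|G|$. A triple $(A,B,C)$ of subsets of $\mathbb{Z}_n$ is equilateral trapezoid-free if for every fixed $a'\in A,b'\in B,c'\in C$ each of the systems $0=a'+b+c=a+b'+c$; $0=a'+b+c=a+b+c'$; $0=a+b'+c=a+b+c'$ has at most one solution $(a,b,c)\in A\times B\times C$; $\mathrm{val}(\mathbb{Z}_n)$ is the maximum over such triples of the number of $(a,b,c)\in A\times B\times C$ with $a+b+c=0$. *)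

(* Defs.v *)
From mathcomp Require Import all_boot all_order all_algebra.
From mathcomp Require Import all_classical all_reals all_analysis.

Set Implicit Arguments.
Unset Strict Implicit.
Unset Printing Implicit Defensive.

Import Order.TTheory GRing.Theory Num.Theory.
Local Open Scope ring_scope.

Section TripleProduct.
Variable G : finZmodType.
Implicit Types A B S T U : {set G}.

Definition diffset A B : {set G} := [set a - b | a in A, b in B].

Definition TPP S T U : Prop :=
  forall s s' t t' u u' : G,
    s \in S -> s' \in S -> t \in T -> t' \in T -> u \in U -> u' \in U ->
    (s - s') + (t - t') + (u - u') = 0 ->
    [/\ s = s', t = t' & u = u'].

Definition STPP (k : nat) (S T U : 'I_k -> {set G}) : Prop :=
  (forall i, TPP (S i) (T i) (U i)) /\
  (forall (i j l : 'I_k) (x y z : G),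
    x \in diffset (S i) (T i) -> y \in diffset (T j) (U j) ->
    z \in diffset (U l) (S l) ->
    x + y + z = 0 -> i = j /\ j = l).

End TripleProduct.

Definition achieves_omega2 (R : realType) (F : finZmodType -> Prop) : Prop :=
  forall delta : R, 0 < delta ->
  exists G : finZmodType, F G /\
  exists (k : nat) (S T U : 'I_k -> {set G}),
    STPP S T U /\
    #|G|%:R <
      \sum_(i < k) (#|S i| * #|T i| * #|U i|)%N%:R `^ ((2 + delta) / 3).

Definition prime_power (q : nat) : Prop :=
  exists p e : nat, [/\ prime p, (0 < e)%N & q = (p ^ e)%N].

(* A prime power is at least 2, so 'Z_q is really the integers mod q here. *)
Inductive prime_power_family : finZmodType -> Prop :=
  PrimePowerFamily (q l : nat) :
    prime_power q -> (0 < l)%N -> prime_power_family 'rV['Z_q]_l.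

Section TrapezoidFree.
Variable G : finZmodType.
Implicit Types A B C : {set G}.

Definition solutions A B C (P : G -> G -> G -> bool) : {set G * G * G} :=
  [set x : G * G * G | let: (a, b, c) := x in
    [&& a \in A, b \in B, c \in C & P a b c]].

Definition at_most_one A B C (P : G -> G -> G -> bool) : bool :=
  (#|solutions A B C P| <= 1)%N.

Definition trapezoid_free A B C : bool :=
  [forall a' in A, forall b' in B, forall c' in C,
    [&& at_most_one A B C (fun a b c => (a' + b + c == 0) && (a + b' + c == 0)),
        at_most_one A B C (fun a b c => (a' + b + c == 0) && (a + b + c' == 0)) &
        at_most_one A B C (fun a b c => (a + b' + c == 0) && (a + b + c' == 0))]].

Definition zero_sums A B C : {set G * G * G} :=
  solutions A B C (fun a b c => a + b + c == 0).

Definition trapezoid_val : nat :=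
  \max_(X : {set G} * {set G} * {set G} | trapezoid_free X.1.1 X.1.2 X.2)
    #|zero_sums X.1.1 X.1.2 X.2|.

End TrapezoidFree.

(* The integers mod n are 'I_n, whose group structure requires n in successor
   form; unlike 'Z_n, this also gives the trivial group for n = 1. *)
Definition val_Z (n : nat) : nat := trapezoid_val 'I_n.-1.+1.

(* Main.v *)
Require Import Defs.
From mathcomp Require Import all_boot all_order all_algebra.
From mathcomp Require Import all_classical all_reals all_analysis.
From mathcomp Require Import zify ring lra.

Set Implicit Arguments.
Unset Strict Implicit.
Unset Printing Implicit Defensive.

Import Order.TTheory GRing.Theory Num.Theory.
Local Open Scope ring_scope.

(** Let [p_i = |S_i||T_i||U_i|] for an STPP in [G = Z_q^L], and [N = |G|].  The sets of all
    differences [S_i - T_i], [T_i - U_i], [U_i - S_i] form a trapezoid-free triple with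
    [sum p_i] zero sums.  The polynomial method in characteristic [p | q] gives
    [sum p_i^(2/3) <= (0.95)^L N]: the indicator of [x + y + z = 0] is a sum of products of
    binomial monomials of total degree [(q-1)L], and a Gaussian elimination along orders for
    which the support of the STPP is an antichain assigns distinct monomials to the
    differences, with degrees summing to at most [(q-1)L] on each zero sum; these monomials
    are then counted with exponential weights.  Since [omega = 2] makes
    [sum p_i^((2+delta)/3) > N] for a tiny [delta], most of this sum comes from huge [p_i],
    whence [sum p_i >= 10^L N].  Finally the [m]-th power of [G] embeds into any [Z_n] with
    [n >= (3q)^(Lm)] by writing digits in base [3q]; fixing the carries loses a factor
    [3^(Lm)], and [(10 q / 3)^(Lm)] is a power of [(3q)^(Lm)] with exponent above 1. *)

(** * Trapezoid-freeness as rigidity of the set of zero sums *)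

Section Rigid.
Variable G : finZmodType.
Implicit Types (A B C : {set G}) (Z : {set G * G * G}).

(* For [s] the coordinate shared by two zero sums, this is one of the three systems in the
   definition of trapezoid-freeness, the fixed entries being [p z1 = p w1] and [r z2 = r w2]. *)
Definition rigid Z (p r s : G * G * G -> G) : Prop :=
  forall z1 z2 w1 w2, z1 \in Z -> z2 \in Z -> w1 \in Z -> w2 \in Z ->
    p z1 = p w1 -> r z2 = r w2 -> s z1 = s z2 -> s w1 = s w2 ->
    z1 = w1 /\ z2 = w2.

Definition pr1 (x : G * G * G) := x.1.1.
Definition pr2 (x : G * G * G) := x.1.2.
Definition pr3 (x : G * G * G) := x.2.

Definition trapezoid_rigid Z :=
  [/\ rigid Z pr1 pr2 pr3, rigid Z pr1 pr3 pr2 & rigid Z pr2 pr3 pr1].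

Lemma mem_zero_sums A B C a b c :
  ((a, b, c) \in zero_sums A B C) =
  [&& a \in A, b \in B, c \in C & a + b + c == 0].
Proof. by rewrite inE. Qed.

(** A solution of one of the systems is a pair of zero sums sharing a coordinate, so two solutions
    supply the four zero sums that [rigid] compares. *)
Lemma rigid_trapezoid_free A B C :
  trapezoid_rigid (zero_sums A B C) -> trapezoid_free A B C.
Proof.
move=> [h1 h2 h3].
apply/forall_inP => a' Aa'; apply/forall_inP => b' Bb'; apply/forall_inP => c' Cc'.
apply/and3P; split; apply/card_le1_eqP => -[[a b] c] [[a2 b2] c2];
  rewrite !inE => /and4P[Aa Bb Cc /andP[e1 e2]] /and4P[Aa2 Bb2 Cc2 /andP[e3 e4]].
- have [] := h1 (a', b, c) (a, b', c) (a', b2, c2) (a2, b', c2);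
    rewrite ?mem_zero_sums ?Aa' ?Bb' ?Cc' ?Aa ?Bb ?Cc ?Aa2 ?Bb2 ?Cc2 //=.
  by move=> [-> ->] [->].
- have [] := h2 (a', b, c) (a, b, c') (a', b2, c2) (a2, b2, c');
    rewrite ?mem_zero_sums ?Aa' ?Bb' ?Cc' ?Aa ?Bb ?Cc ?Aa2 ?Bb2 ?Cc2 //=.
  by move=> [-> ->] [->].
- have [] := h3 (a, b', c) (a, b, c') (a2, b', c2) (a2, b2, c');
    rewrite ?mem_zero_sums ?Aa' ?Bb' ?Cc' ?Aa ?Bb ?Cc ?Aa2 ?Bb2 ?Cc2 //=.
  by move=> [-> ->] [->].
Qed.

Definition rigid_sums (T : nat) : Prop := exists A B C,
  trapezoid_rigid (zero_sums A B C) /\ (T <= #|zero_sums A B C|)%N.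

Lemma rigid_sums_val T : rigid_sums T -> (T <= trapezoid_val G)%N.
Proof.
move=> [A [B [C [/rigid_trapezoid_free h /leq_trans]]]]; apply.
exact: (leq_bigmax_cond (A, B, C)).
Qed.

Lemma rigid_sumsW T T' : (T' <= T)%N -> rigid_sums T -> rigid_sums T'.
Proof.
by move=> le [A [B [C [h ?]]]]; exists A, B, C; split=> //; apply: leq_trans le _.
Qed.

End Rigid.

(** * Rigid zero sums in powers of a group *)

Section Power.
Variables (G : finZmodType) (m : nat).

Definition setpow (A : {set G}) : {set 'rV[G]_m} :=
  [set f : 'rV[G]_m | [forall k, f 0 k \in A]].

Lemma zero_sums_pow A B C f g h :
  (f, g, h) \in zero_sums (setpow A) (setpow B) (setpow C) <->
  forall k, (f 0 k, g 0 k, h 0 k) \in zero_sums A B C.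
Proof.
rewrite mem_zero_sums !inE; split.
  move=> /and4P[/forallP fA /forallP gB /forallP hC /eqP/rowP e] k.
  by rewrite mem_zero_sums fA gB hC /=; move: (e k); rewrite !mxE => ->.
move=> H; apply/and4P; split; first [apply/forallP => k|apply/eqP/rowP=> k];
  move: (H k); rewrite mem_zero_sums => /and4P[] // _ _ _ /eqP.
by rewrite !mxE.
Qed.

Lemma rigid_sums_pow T : rigid_sums G T -> rigid_sums 'rV[G]_m (T ^ m).
Proof.
move=> [A [B [C [[h1 h2 h3] leT]]]].
exists (setpow A), (setpow B), (setpow C); split.
  by split=> -[[a b] c] [[a2 b2] c2] [[a3 b3] c3] [[a4 b4] c4]
    /zero_sums_pow z1 /zero_sums_pow z2 /zero_sums_pow z3 /zero_sums_pow z4;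
  rewrite /pr1 /pr2 /pr3 /= => /rowP e1 /rowP e2 /rowP e3 /rowP e4;
  [ have H k := h1 _ _ _ _ (z1 k) (z2 k) (z3 k) (z4 k) (e1 k) (e2 k) (e3 k) (e4 k)
  | have H k := h2 _ _ _ _ (z1 k) (z2 k) (z3 k) (z4 k) (e1 k) (e2 k) (e3 k) (e4 k)
  | have H k := h3 _ _ _ _ (z1 k) (z2 k) (z3 k) (z4 k) (e1 k) (e2 k) (e3 k) (e4 k)];
  split; do 2?congr pair; apply/rowP => k; case: (H k) => -[? ? ?] [].
pose tr (f : {ffun 'I_m -> G * G * G}) : 'rV[G]_m * 'rV[G]_m * 'rV[G]_m :=
  (\row_k (f k).1.1, \row_k (f k).1.2, \row_k (f k).2).
have tr_inj : injective tr.
  move=> f g [] /rowP e1 /rowP e2 /rowP e3; apply/ffunP => k.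
  move: (e1 k) (e2 k) (e3 k); rewrite !mxE.
  by case: (f k) (g k) => -[? ?] ? [[? ?] ?] /= -> -> ->.
apply: (@leq_trans (#|zero_sums A B C| ^ m)).
  by case: (posnP m) => [->//|m0]; rewrite leq_exp2r.
rewrite -[X in (_ ^ X)%N]card_ord -card_ffun_on -(card_imset _ tr_inj).
apply: subset_leq_card; apply/fintype.subsetP => _ /imsetP[f /ffun_onP fZ ->].
by apply/zero_sums_pow => k; rewrite !mxE; case: (f k) (fZ k) => -[].
Qed.

End Power.

(** * Transfer along injections that reflect zero sums *)

Section Embedding.
Variables (G H : finZmodType) (fa fb fc : G -> H).
Hypotheses (fa_inj : injective fa) (fb_inj : injective fb) (fc_inj : injective fc).
Hypothesis f0 : forall a b c, fa a + fb b + fc c = 0 -> a + b + c = 0.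

(** By [f0] and injectivity the zero sums of the image sets are the images of some of the zero sums
    in [G], and rigidity passes to subsets. *)
Lemma rigid_sums_embed A B C : trapezoid_rigid (zero_sums A B C) ->
  rigid_sums H #|[set x in zero_sums A B C | fa x.1.1 + fb x.1.2 + fc x.2 == 0]|.
Proof.
set Z0 := [set _ in _ | _] => -[h1 h2 h3].
pose F (x : G * G * G) := (fa x.1.1, fb x.1.2, fc x.2).
have F_inj : injective F.
  by move=> [[a b] c] [[a2 b2] c2] [] /fa_inj -> /fb_inj -> /fc_inj ->.
exists (fa @: A), (fb @: B), (fc @: C).
have -> : zero_sums (fa @: A) (fb @: B) (fc @: C) = F @: Z0.
  apply/setP => -[[a b] c]; rewrite mem_zero_sums; apply/idP/imsetP.
    move=> /and4P[/imsetP[x Ax ->] /imsetP[y By ->] /imsetP[z Cz ->] /eqP e].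
    exists (x, y, z) => //; rewrite inE mem_zero_sums Ax By Cz /=.
    by rewrite (f0 e) e !eqxx.
  move=> [[[x y] z]]; rewrite inE mem_zero_sums => /andP[/and4P[Ax By Cz _] e] [-> -> ->].
  by rewrite !imset_f.
split; last by rewrite card_imset.
split=> _ _ _ _ /imsetP[[[a b] c] + ->] /imsetP[[[a2 b2] c2] + ->]
  /imsetP[[[a3 b3] c3] + ->] /imsetP[[[a4 b4] c4] + ->];
  rewrite /pr1 /pr2 /pr3 /= => /finset.setIdP[z1 _] /finset.setIdP[z2 _]
  /finset.setIdP[z3 _] /finset.setIdP[z4 _].
- move=> /fa_inj e1 /fb_inj e2 /fc_inj e3 /fc_inj e4.
  by have [-> ->] := h1 _ _ _ _ z1 z2 z3 z4 e1 e2 e3 e4.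
- move=> /fa_inj e1 /fc_inj e2 /fb_inj e3 /fb_inj e4.
  by have [-> ->] := h2 _ _ _ _ z1 z2 z3 z4 e1 e2 e3 e4.
- move=> /fb_inj e1 /fc_inj e2 /fa_inj e3 /fa_inj e4.
  by have [-> ->] := h3 _ _ _ _ z1 z2 z3 z4 e1 e2 e3 e4.
Qed.

End Embedding.

(** * Rigid zero sums from an STPP *)

Section STPPsums.
Variables (G : finZmodType) (k : nat) (S T U : 'I_k -> {set G}).
Hypothesis STU : STPP S T U.

Lemma telescope3 (x y z : G) : x - y + (y - z) + (z - x) = 0.
Proof. by rewrite !addrA !subrK subrr. Qed.

(** The STPP makes the three indices equal; regrouped by set, the sum is then one to which the TPP
    of that block applies. *)
Lemma stpp_zero (i j l : 'I_k) s t t' u u' s' :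
  s \in S i -> t \in T i -> t' \in T j -> u \in U j -> u' \in U l -> s' \in S l ->
  s - t + (t' - u) + (u' - s') = 0 -> [/\ i = j, j = l, s = s', t = t' & u = u'].
Proof.
case: STU => tpp stpp Ss Tt Tt' Uu Uu' Ss' e.
have [ij jl] : i = j /\ j = l.
  by apply: stpp e; apply/imset2P; [exists s t|exists t' u|exists u' s'].
subst j l; have [] // := tpp i s s' t' t u' u Ss Ss' Tt' Tt Uu' Uu.
by rewrite -[RHS]e !addrA (ACl (1*4*3*6*5*2)).
Qed.

Definition quads : {set 'I_k * (G * G * G)} :=
  [set x | [&& x.2.1.1 \in S x.1, x.2.1.2 \in T x.1 & x.2.2 \in U x.1]].

Definition quad_sum (x : 'I_k * (G * G * G)) : G * G * G :=
  (x.2.1.1 - x.2.1.2, x.2.1.2 - x.2.2, x.2.2 - x.2.1.1).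

Definition diffs (A B : 'I_k -> {set G}) : {set G} := \bigcup_i diffset (A i) (B i).

Lemma card_quads : #|quads| = (\sum_(i < k) #|S i| * #|T i| * #|U i|)%N.
Proof.
rewrite -sum1_card -(eq_bigl _ _ (fun x => erefl (x \in quads))).
pose STUi i := finset.setX (finset.setX (S i) (T i)) (U i).
rewrite (eq_bigl (fun x => xpredT x.1 && (x.2 \in STUi x.1))); last first.
  by move=> [i [[s t] u]]; rewrite !inE /= andbA.
rewrite -(pair_big_dep xpredT (fun i x => x \in STUi i) (fun _ _ => 1%N)) /=.
by apply: eq_bigr => i _; rewrite sum1_card !cardsX.
Qed.

(** A difference shared by both quads is completed to a zero sum by the other two differences of one
    of them, and [stpp_zero] applies to this mixed sum. *)
Lemma quads_rigid x y : x \in quads -> y \in quads ->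
  [/\ (quad_sum x).1.1 = (quad_sum y).1.1 -> [/\ x.1 = y.1, x.2.1.1 = y.2.1.1 & x.2.1.2 = y.2.1.2],
      (quad_sum x).1.2 = (quad_sum y).1.2 -> [/\ x.1 = y.1, x.2.1.2 = y.2.1.2 & x.2.2 = y.2.2] &
      (quad_sum x).2 = (quad_sum y).2 -> [/\ x.1 = y.1, x.2.1.1 = y.2.1.1 & x.2.2 = y.2.2]].
Proof.
case: x y => [i [[s t] u]] [j [[s2 t2] u2]]; rewrite !inE /=.
move=> /and3P[Ss Tt Uu] /and3P[Ss2 Tt2 Uu2]; split=> e.
- have [] // := @stpp_zero i j j s t t2 u2 u2 s2; by rewrite // e telescope3.
- by have [//|_ -> _ -> ->] := stpp_zero Ss2 Tt2 Tt Uu Uu2 Ss2; rewrite ?e ?telescope3.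
- by have [|_ -> -> _ ->] := stpp_zero Ss2 Tt2 Tt2 Uu2 Uu Ss; rewrite ?e ?telescope3.
Qed.

Lemma zero_sums_quads :
  zero_sums (diffs S T) (diffs T U) (diffs U S) = quad_sum @: quads.
Proof.
apply/setP => -[[a b] c]; rewrite mem_zero_sums; apply/idP/imsetP.
  move=> /and4P[/finset.bigcupP[i _ /imset2P[s t Ss Tt ->]]].
  move=> /finset.bigcupP[j _ /imset2P[t' u Tt' Uu ->]].
  move=> /finset.bigcupP[l _ /imset2P[u' s' Uu' Ss' ->]] /eqP e.
  have [ij jl es et eu] := stpp_zero Ss Tt Tt' Uu Uu' Ss' e; subst.
  by exists (l, (s', t', u')); rewrite ?inE /= ?Ss ?Tt ?Uu.
move=> [[i [[s t] u]]]; rewrite inE /= => /and3P[Ss Tt Uu] [-> -> ->].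
apply/and4P; split; last by rewrite telescope3.
- by apply/finset.bigcupP; exists i => //; apply/imset2P; exists s t.
- by apply/finset.bigcupP; exists i => //; apply/imset2P; exists t u.
- by apply/finset.bigcupP; exists i => //; apply/imset2P; exists u s.
Qed.

Lemma stpp_rigid_sums : rigid_sums G (\sum_(i < k) #|S i| * #|T i| * #|U i|)%N.
Proof.
exists (diffs S T), (diffs T U), (diffs U S).
rewrite zero_sums_quads; split; last first.
  rewrite -card_quads card_in_imset // => x y Qx Qy [e1 e2 _].
  have [h1 h2 _] := quads_rigid Qx Qy.
  have [E1 E2 E3] := h1 e1; have [_ _ E4] := h2 e2.
  by case: x y E1 E2 E3 E4 {Qx Qy e1 e2 h1 h2} => ? [[? ?] ?] [? [[? ?] ?]] /= -> -> -> ->.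
(* Each entry fixes the index and two of [s], [t], [u]; following these around the four quads
   identifies them in pairs. *)
split=> _ _ _ _ /imsetP[x1 Q1 ->] /imsetP[x2 Q2 ->] /imsetP[x3 Q3 ->] /imsetP[x4 Q4 ->] e1 e2 e3 e4;
  have [a13 b13 c13] := quads_rigid Q1 Q3; have [a24 b24 c24] := quads_rigid Q2 Q4;
  have [a12 b12 c12] := quads_rigid Q1 Q2; have [a34 b34 c34] := quads_rigid Q3 Q4.
- have [A1 A2 A3] := a13 e1; have [B1 B2 B3] := b24 e2; have [C1 C2 C3] := c12 e3.
  have [D1 D2 D3] := c34 e4.
  by split; congr quad_sum; move: A1 A2 A3 B1 B2 B3 C1 C2 C3 D1 D2 D3;
   clear; case: x1 x2 x3 x4 => ? [[? ?] ?] [? [[? ?] ?]] [? [[? ?] ?]] [? [[? ?] ?]] /=;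
   intros; subst.
- have [A1 A2 A3] := a13 e1; have [B1 B2 B3] := c24 e2; have [C1 C2 C3] := b12 e3.
  have [D1 D2 D3] := b34 e4.
  by split; congr quad_sum; move: A1 A2 A3 B1 B2 B3 C1 C2 C3 D1 D2 D3;
   clear; case: x1 x2 x3 x4 => ? [[? ?] ?] [? [[? ?] ?]] [? [[? ?] ?]] [? [[? ?] ?]] /=;
   intros; subst.
- have [A1 A2 A3] := b13 e1; have [B1 B2 B3] := c24 e2; have [C1 C2 C3] := a12 e3.
  have [D1 D2 D3] := a34 e4.
  by split; congr quad_sum; move: A1 A2 A3 B1 B2 B3 C1 C2 C3 D1 D2 D3;
   clear; case: x1 x2 x3 x4 => ? [[? ?] ?] [? [[? ?] ?]] [? [[? ?] ?]] [? [[? ?] ?]] /=;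
   intros; subst.
Qed.

End STPPsums.

(** * Uniqueness of digits in base [b] *)

Section Digits.
Local Open Scope nat_scope.

Lemma digits_lt b K (d : 'I_K -> nat) : (forall i, d i < b) ->
  \sum_(i < K) d i * b ^ i < b ^ K.
Proof.
elim: K d => [|K IH] d db; first by rewrite big_ord0.
rewrite big_ord_recr /= expnS; have := IH (fun i => d (widen_ord (leqnSn K) i)) (fun i => db _).
have := db ord_max; move: (d ord_max) (\sum_(i < K) _) (b ^ K) => x s B xb sB.
by rewrite (@leq_trans (B + x * B)) ?ltn_add2r // -mulSn leq_mul2r xb orbT.
Qed.

Lemma digits_inj b K (d e : 'I_K -> nat) : (forall i, d i < b) -> (forall i, e i < b) ->
  \sum_(i < K) d i * b ^ i = \sum_(i < K) e i * b ^ i -> d =1 e.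
Proof.
elim: K d e => [|K IH] d e db eb; first by move=> _ [].
rewrite !big_ord_recr /= => E.
have dl := digits_lt (fun i => db (widen_ord (leqnSn K) i)).
have el := digits_lt (fun i => eb (widen_ord (leqnSn K) i)).
have B0 : 0 < b ^ K by rewrite expn_gt0 (leq_ltn_trans _ (db ord_max)).
have top : d ord_max = e ord_max.
  have := congr1 (divn^~ (b ^ K)) E.
  by rewrite ![(\sum_(i < K) _ + _)%N]addnC !divnMDl // !divn_small ?addn0.
have low : \sum_(i < K) d (widen_ord (leqnSn K) i) * b ^ i =
           \sum_(i < K) e (widen_ord (leqnSn K) i) * b ^ i.
  by move/eqP: E; rewrite top eqn_add2r => /eqP.
have {}IH := IH _ _ (fun i => db _) (fun i => eb _) low.
move=> i; case: (unliftP ord_max i) => [j ->|-> //].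
have -> : lift ord_max j = widen_ord (leqnSn K) j.
  by apply: val_inj; rewrite /= /bump leqNgt ltn_ord.
exact: IH.
Qed.

End Digits.

Lemma ord_sum3_eq0 n (a b c : 'I_n.+1) :
  (a + b + c == 0) = (n.+1 %| a + b + c)%N.
Proof. by rewrite -val_eqE /= modnDml. Qed.

Lemma inZpD n (x y : nat) : inZp (x + y) = inZp x + inZp y :> 'I_n.+1.
Proof. by apply: val_inj; rewrite /= modnDm. Qed.

(** * Embedding into the integers mod [n.+1] by digits and carries *)

Section CarryEmbedding.
Variables (q L m n : nat).
Let Q := q.+1.
Let K := #|{: 'I_m * 'I_L}|.
Hypothesis nK : ((3 * Q) ^ K <= n.+1)%N.
Let G : finZmodType := 'rV['rV['I_Q]_L]_m.

Let digit (f : G) (i : 'I_K) : nat := f 0 (enum_val i).1 0 (enum_val i).2.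
Let num (f : G) : nat := (\sum_(i < K) digit f i * (3 * Q) ^ i)%N.
(* The base [3 * Q] prevents carries between digits, so [f + g + h = 0] in [G] iff
   [num f + num g + num h] is one of these numbers. *)
Let carry (v : {ffun 'I_K -> 'I_3}) : nat := (\sum_(i < K) (Q * v i) * (3 * Q) ^ i)%N.

Let digitQ f i : (digit f i < Q)%N. Proof. exact: ltn_ord. Qed.

Let digit_inj f g : digit f =1 digit g -> f = g.
Proof.
move=> e; apply/rowP => k; apply/rowP => l; apply: val_inj.
by have := e (enum_rank (k, l)); rewrite /digit enum_rankK.
Qed.

Let num_lt f : (num f < n.+1)%N.
Proof.
apply: leq_trans nK; apply: digits_lt => i.
by apply: (leq_trans (digitQ f i)); rewrite leq_pmull.
Qed.

Let num_inj f g : num f = num g -> f = g.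
Proof.
move=> e; apply: digit_inj; apply: digits_inj e => i;
  by apply: (leq_trans (digitQ _ i)); rewrite leq_pmull.
Qed.

Let inZp_num_inj : injective (fun f => inZp (num f) : 'I_n.+1).
Proof. by move=> f g /(congr1 val) /=; rewrite !modn_small ?num_lt // => /num_inj. Qed.

Let num3 f g h : (num f + num g + num h =
  \sum_(i < K) (digit f i + digit g i + digit h i) * (3 * Q) ^ i)%N.
Proof. by rewrite -!big_split /=; apply: eq_bigr => i _; rewrite !mulnDl. Qed.

Let digit3_lt f g h i : (digit f i + digit g i + digit h i < 3 * Q)%N.
Proof. by have := digitQ f i; have := digitQ g i; have := digitQ h i; lia. Qed.

Let digit3_eq0 f g h :
  (f + g + h == 0) = [forall i, (Q %| digit f i + digit g i + digit h i)%N].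
Proof.
apply/eqP/forallP => [e i|e].
  rewrite /digit -ord_sum3_eq0.
  by move/rowP/(_ (enum_val i).1)/rowP/(_ (enum_val i).2): e; rewrite !mxE => ->.
apply/rowP => k; apply/rowP => l; rewrite !mxE; apply/eqP; rewrite ord_sum3_eq0.
by have := e (enum_rank (k, l)); rewrite /digit enum_rankK.
Qed.

Let carry_digit_lt (v : {ffun 'I_K -> 'I_3}) i : (Q * v i < 3 * Q)%N.
Proof. by rewrite mulnC ltn_mul2r ltn_ord. Qed.

Let embed0 v f g h :
  inZp (num f) + inZp (num g) + (inZp (num h) - inZp (carry v)) = 0 :> 'I_n.+1 <->
  (num f + num g + num h)%N = carry v.
Proof.
rewrite addrA -!inZpD; split=> [/eqP|->]; last by rewrite subrr.
rewrite subr_eq0 => /eqP/(congr1 val) /=; rewrite !modn_small //.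
  by apply: leq_trans nK; apply: digits_lt.
by apply: leq_trans nK; rewrite num3; apply: digits_lt.
Qed.

(** Every zero sum of [G] has one of [3 ^ (m * L)] carry vectors. For a fixed [v], subtracting
    [carry v] from the third image keeps exactly the zero sums with that carry, so each class has at
    most [val_Z n.+1] elements. *)
Lemma rigid_sums_val_Z T : rigid_sums G T -> (T <= 3 ^ (m * L) * val_Z n.+1)%N.
Proof.
move=> [A [B [C [rig /leq_trans]]]]; apply.
pose Zv v := [set x in zero_sums A B C |
  inZp (num x.1.1) + inZp (num x.1.2) + (inZp (num x.2) - inZp (carry v)) == 0 :> 'I_n.+1].
have Zv_le v : (#|Zv v| <= val_Z n.+1)%N.
  apply: rigid_sums_val; apply: (rigid_sums_embed
    (fa := fun f => inZp (num f)) (fb := fun f => inZp (num f))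
    (fc := fun f => inZp (num f) - inZp (carry v))) rig => //.
    by move=> f g /addIr/inZp_num_inj.
  move=> f g h /embed0; rewrite num3 => e; apply/eqP; rewrite digit3_eq0.
  apply/forallP => i; rewrite (digits_inj _ _ e i) ?dvdn_mulr //.
have -> : (3 ^ (m * L) * val_Z n.+1 = \sum_(v : {ffun 'I_K -> 'I_3}) val_Z n.+1)%N.
  by rewrite sum_nat_const card_ffun !card_ord /K card_prod !card_ord.
apply: (@leq_trans (\sum_v #|Zv v|)%N); last by apply: leq_sum => v _.
under eq_bigr do rewrite -sum1_card big_mkcond /=.
rewrite exchange_big /= -sum1_card [leqLHS]big_mkcond /=.
apply: leq_sum => -[[f g] h] _; case: ifP => // Zx.
(* Each digit sum of a zero sum is [Q] times a number below 3; these quotients form its carry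
   vector. *)
have div3 i : ((digit f i + digit g i + digit h i) %/ Q < 3)%N by rewrite ltn_divLR.
rewrite (bigD1 [ffun i => Ordinal (div3 i)]) //= inE Zx /=.
suff /embed0-> : (num f + num g + num h)%N = carry [ffun i => Ordinal (div3 i)] by rewrite eqxx.
rewrite num3; apply: eq_bigr => i _; rewrite ffunE /= mulnC [(Q * _)%N]mulnC divnK //.
  by rewrite mulnC.
by move: Zx; rewrite mem_zero_sums digit3_eq0 => /and4P[_ _ _ /forallP].
Qed.

End CarryEmbedding.

(** * Gaussian elimination with pivots of controlled degree *)

Section Echelon.
Variables (F : fieldType) (J E : finType) (P : {pred J}).
Variables (disp : Order.disp_t) (O : orderType disp) (key : J -> O).
Variables (deg : E -> nat) (w : E -> J -> F).
Hypothesis key_inj : {in P &, injective key}.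
Hypothesis indep : forall x : J -> F, (forall j, j \notin P -> x j = 0) ->
  (forall e, \sum_j x j * w e j = 0) -> forall j, x j = 0.

Definition leads (x : J -> F) (j : J) : Prop :=
  x j = 1 /\ forall j', x j' != 0 -> j' \in P /\ (key j' <= key j)%O.

(* A total order refining [deg]. *)
Let lev (e : E) : nat := (deg e * #|E| + enum_rank e)%N.

Let lev_inj : injective lev.
Proof.
move=> e e' H; apply: enum_rank_inj; apply: val_inj.
have := congr1 (modn^~ #|E|) H; by rewrite !modnMDl !modn_small.
Qed.

Let lev_deg e e' : (deg e < deg e')%N -> (lev e < lev e')%N.
Proof.
move=> lt; apply: (@leq_trans ((deg e).+1 * #|E|)).
  by rewrite mulSn /lev addnC ltn_add2r.
by apply: leq_trans (leq_addr _ _); rewrite leq_mul2r lt orbT.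
Qed.

Let kills (x : J -> F) n := forall e, (lev e < n)%N -> \sum_j x j * w e j = 0.

(** The pivot has the largest level [n] such that some vector led by [j] kills all columns below
    [n]; independence bounds these levels. *)
Let pivot j : j \in P -> exists e,
  (exists x, leads x j /\ kills x (lev e)) /\
  (forall x, leads x j -> kills x (lev e) -> \sum_j x j * w e j != 0).
Proof.
move=> Pj; pose ok n := `[< exists x, leads x j /\ kills x n >].
have ok0 : exists n, ok n.
  exists 0%N; apply/asboolP; exists (fun j' => (j' == j)%:R); split=> //.
  split=> [|j']; first by rewrite eqxx.
  by case: (eqVneq j' j) => [-> _|_]; [rewrite lexx|rewrite eqxx].
have okb n : ok n -> (n <= \max_e lev e)%N.
  move=> /asboolP[x [[xj lx] kx]]; rewrite leqNgt; apply/negP => lt.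
  have /(_ j)/eqP : forall j, x j = 0.
    apply: indep => [j' NP|e]; first by apply/eqP; apply: contraNT NP => /lx[].
    by apply: kx; apply: leq_ltn_trans lt; apply: leq_bigmax.
  by rewrite xj oner_eq0.
case: (ex_maxnP ok0 okb) => n /asboolP[x [lx kx]] max_n.
have no_ok y : leads y j -> kills y n.+1 -> False.
  by move=> ly ky; have /max_n : ok n.+1; [apply/asboolP; exists y|rewrite ltnn].
(* If no column had level [n], killing the levels below [n] would kill those below [n.+1], against
   maximality. *)
have [e en|none] := pickP (fun e => lev e == n); last first.
  case: (no_ok x lx) => e; rewrite ltnS leq_eqVlt none /=; exact: kx.
exists e; rewrite (eqP en); split; first by exists x.
move=> y ly ky; apply/eqP => y0; apply: (no_ok y ly) => e'.
rewrite ltnS leq_eqVlt => /orP[/eqP e'n|/ky //].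
by have -> : e' = e by apply: lev_inj; rewrite e'n (eqP en).
Qed.

(* [phi j] is the column where the vectors with leading entry [j] that vanish as long as
   possible stop vanishing; two equal pivots could be cancelled against each other. *)
Lemma echelon (e0 : E) : exists phi : J -> E,
  {in P &, injective phi} /\
  forall j, j \in P -> exists x, leads x j /\
    forall e, (deg e < deg (phi j))%N -> \sum_j x j * w e j = 0.
Proof.
have /choice[phi phiP] : forall j, exists e, j \in P ->
    (exists x, leads x j /\ kills x (lev e)) /\
    (forall x, leads x j -> kills x (lev e) -> \sum_j x j * w e j != 0).
  move=> j; case: (boolP (j \in P)) => [/pivot[e H]|_]; last by exists e0.
  by exists e.
exists phi; split=> [|j /phiP[[x [lx kx]] _]]; last first.
  by exists x; split=> // e /lev_deg; apply: kx.
suff H i j : i \in P -> j \in P -> (key i < key j)%O -> phi i = phi j -> False.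
  move=> i j Pi Pj e; case: (ltgtP (key i) (key j)) => [lt|gt|/key_inj-> //].
    by case: (H i j).
  by case: (H j i).
move=> Pi Pj lt e.
have [[x [lx kx]] nx] := phiP _ Pj; have [[y [ly ky]] ny] := phiP _ Pi.
rewrite e in ky ny; have {nx ny} := (nx x lx kx, ny y ly ky).
set u := \sum_j0 x _ * _; set v := \sum_j0 y _ * _ => -[u0 v0].
have yj : y j = 0.
  by apply/eqP; apply: contraTT lt => /(proj2 ly)[_]; rewrite leNgt.
pose z k := x k - u / v * y k.
have sz e' : \sum_k z k * w e' k = \sum_k x k * w e' k - u / v * \sum_k y k * w e' k.
  by rewrite mulr_sumr -sumrB; apply: eq_bigr => k _; rewrite mulrBl mulrA.
have lz : leads z j.
  split; first by rewrite /z yj mulr0 subr0 (proj1 lx).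
  move=> k zk; have [xk|/(proj2 lx)//] := eqVneq (x k) 0.
  have /(proj2 ly)[Pk le] : y k != 0.
    by apply: contraNneq zk => yk; rewrite /z xk yk mulr0 subr0.
  by split=> //; apply: le_trans le (ltW lt).
have kz : kills z (lev (phi j)).
  by move=> e' lt'; rewrite sz kx // ky // mulr0 subr0.
have [_ /(_ z lz kz)/eqP[]] := phiP _ Pj.
by rewrite sz -/u -/v divfK ?subrr.
Qed.

End Echelon.

Lemma sum_prod3 (R : pzSemiRingType) (I J K : finType) (a : I -> R) (b : J -> R) (c : K -> R) :
  (\sum_i a i) * (\sum_j b j) * (\sum_k c k) = \sum_i \sum_j \sum_k a i * b j * c k.
Proof.
rewrite big_distrlr /= mulr_suml; apply: eq_bigr => i _.
by rewrite mulr_suml; apply: eq_bigr => j _; rewrite mulr_sumr.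
Qed.

Lemma sum_pred1 (R : pzSemiRingType) (I : finType) (i : I) : \sum_j (j == i)%:R = 1 :> R.
Proof. by rewrite (bigD1 i) //= eqxx big1 ?addr0 // => j /negPf->. Qed.

(** * Degree bound on the differences of an STPP *)

Section DegreeBound.
Variables (G : finZmodType) (F : fieldType) (E I : finType) (ok : pred I).
Variables (f g h : E -> G -> F) (pf pg ph : I -> E) (deg : E -> nat) (D : nat).
Hypothesis decomp : forall x y z, (x + y + z == 0)%:R =
  \sum_(o | ok o) f (pf o) x * g (pg o) y * h (ph o) z.
Hypothesis degD : forall o, ok o -> (deg (pf o) + deg (pg o) + deg (ph o) <= D)%N.

(** The witness [c] writes the indicator of [j] on [P] as a combination of columns, so a vector
    orthogonal to all columns has entry 0 at [j]. *)
Lemma indep_of_decomp (w : E -> G -> F) (pw : I -> E) (J : finType) (P : {pred J}) (v : J -> G) :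
  (forall j, j \in P -> exists c : I -> F, forall j', j' \in P ->
     (j' == j)%:R = \sum_(o | ok o) w (pw o) (v j') * c o) ->
  forall x : J -> F, (forall j, j \notin P -> x j = 0) ->
    (forall e, \sum_j x j * w e (v j) = 0) -> forall j, x j = 0.
Proof.
move=> H x xP xw j; case: (boolP (j \in P)) => [/H[c Hc]|/xP //].
transitivity (\sum_j' x j' * (j' == j)%:R).
  by rewrite (bigD1 j) //= eqxx mulr1 big1 ?addr0 // => j' /negPf->; rewrite mulr0.
transitivity (\sum_j' \sum_(o | ok o) x j' * w (pw o) (v j') * c o).
  apply: eq_bigr => j' _; case: (boolP (j' \in P)) => [/Hc->|/xP->].
    by rewrite mulr_sumr; apply: eq_bigr => o _; rewrite mulrA.
  by rewrite mul0r big1 // => o _; rewrite !mul0r.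
by rewrite exchange_big big1 //= => o _; rewrite -mulr_suml xw mul0r.
Qed.

Variables (k : nat) (S T U : 'I_k -> {set G}).
Hypothesis STU : STPP S T U.

(** Nonemptiness of the third set lets each pair be completed to a zero sum, on which the
    independence of the rows rests. *)
Definition block (A B C : 'I_k -> {set G}) : {set 'I_k * (G * G)} :=
  [set x | [&& x.2.1 \in A x.1, x.2.2 \in B x.1 & C x.1 != finset.set0]].

Let v (x : 'I_k * (G * G)) : G := x.2.1 - x.2.2.
Let rk (x : G) : int := (enum_rank x)%:Z.
(* Lexicographic orders making the triples [(i,s,t), (i,t,u), (i,u,s)] an antichain; the sum of
   products of three leading vectors then reduces to its leading term. *)
Let key1 (x : 'I_k * (G * G)) : int *l (int *l int) := (x.1%:Z, (rk x.2.1, - rk x.2.2)).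
Let key2 (x : 'I_k * (G * G)) : int *l (int *l int) := (- x.1%:Z, (- rk x.2.2, rk x.2.1)).
Let key3 (x : 'I_k * (G * G)) : int *l (int *l int) := (- x.1%:Z, (rk x.2.1, - rk x.2.2)).

Let rk_inj : injective rk.
Proof. by move=> x y [] /val_inj /enum_rank_inj. Qed.

Let key1_inj : injective key1.
Proof.
by move=> [i [s t]] [j [s' t']] [] /val_inj -> /val_inj/enum_rank_inj -> /oppr_inj/rk_inj ->.
Qed.

Let key2_inj : injective key2.
Proof.
by move=> [i [s t]] [j [s' t']] [] /oppr_inj[]/val_inj -> /oppr_inj/rk_inj -> /val_inj/enum_rank_inj->.
Qed.

Let key3_inj : injective key3.
Proof.
by move=> [i [s t]] [j [s' t']] [] /oppr_inj[]/val_inj -> /val_inj/enum_rank_inj -> /oppr_inj/rk_inj->.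
Qed.

(** The keys bound the index, then [u], then [s], then [t] from both sides, each time using the
    equalities already found. *)
Let antichain (i i' : 'I_k) s t u s' t' u' :
  (key1 (i', (s', t')) <= key1 (i, (s, t)))%O ->
  (key2 (i', (t', u')) <= key2 (i, (t, u)))%O ->
  (key3 (i', (u', s')) <= key3 (i, (u, s)))%O ->
  [/\ i' = i, s' = s, t' = t & u' = u].
Proof.
rewrite /key1 /key2 /key3 !lexi_pair /= !lerN2.
move=> /andP[i1 H1] /andP[i2 H2] /andP[_ H3]; move: H1 H2 H3; rewrite i1 i2 /=.
move=> /andP[s1 H1] /andP[u1 H2] /andP[u2 H3]; move: H1 H2 H3; rewrite u1 /=.
move=> H1 H2 s2; move: H1 H2; rewrite s2 u2 /= => t1 t2.
split; try by apply/rk_inj/le_anti; apply/andP.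
by apply: val_inj; apply/eqP; rewrite eqn_leq; apply/andP.
Qed.

(** Sum the zero-sum indicator against the three leading vectors. By [antichain] the result is 1.
    Were the degree sum above [D], every term of [decomp] would contain a factor of degree below its
    pivot, and the result would be 0. *)
Lemma stpp_degree (e0 : E) : exists phi1 phi2 phi3 : 'I_k * (G * G) -> E,
  [/\ {in block S T U &, injective phi1}, {in block T U S &, injective phi2},
      {in block U S T &, injective phi3} &
      forall i s t u, s \in S i -> t \in T i -> u \in U i ->
        (deg (phi1 (i, (s, t))) + deg (phi2 (i, (t, u))) + deg (phi3 (i, (u, s))) <= D)%N].
Proof.
have indep1 := @indep_of_decomp f pf _ (block S T U) v.
have indep2 := @indep_of_decomp g pg _ (block T U S) v.
have indep3 := @indep_of_decomp h ph _ (block U S T) v.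
have [|phi1 [inj1 H1]] := echelon (w := fun e x => f e (v x)) deg
  (in2W key1_inj) (indep1 _) e0.
  move=> [i [s t]]; rewrite inE => /and3P[/= Ss Tt /finset.set0Pn[u Uu]].
  (* With [t - u] and [u - s] fixed, [decomp] is the indicator of [(i, (s, t))] on the block, by
     [stpp_zero]. *)
  exists (fun o => g (pg o) (t - u) * h (ph o) (u - s)) => -[i' [s' t']].
  rewrite inE => /and3P[/= Ss' Tt' _]; under eq_bigr do rewrite mulrA.
  rewrite -decomp /v /=; congr ((_ : bool)%:R); apply/eqP/eqP => [[_ -> ->]|].
    exact: telescope3.
  by move=> /(stpp_zero STU Ss' Tt' Tt Uu Uu Ss)[-> _ -> -> _].
have [|phi2 [inj2 H2]] := echelon (w := fun e x => g e (v x)) deg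
  (in2W key2_inj) (indep2 _) e0.
  move=> [i [t u]]; rewrite inE => /and3P[/= Tt Uu /finset.set0Pn[s Ss]].
  exists (fun o => f (pf o) (s - t) * h (ph o) (u - s)) => -[i' [t' u']].
  rewrite inE => /and3P[/= Tt' Uu' _].
  under eq_bigr do rewrite mulrA [g _ _ * _]mulrC.
  rewrite -decomp /v /=; congr ((_ : bool)%:R); apply/eqP/eqP => [[_ -> ->]|].
    exact: telescope3.
  by move=> /(stpp_zero STU Ss Tt Tt' Uu' Uu Ss)[-> _ _ -> ->].
have [|phi3 [inj3 H3]] := echelon (w := fun e x => h e (v x)) deg
  (in2W key3_inj) (indep3 _) e0.
  move=> [i [u s]]; rewrite inE => /and3P[/= Uu Ss /finset.set0Pn[t Tt]].
  exists (fun o => f (pf o) (s - t) * g (pg o) (t - u)) => -[i' [u' s']].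
  rewrite inE => /and3P[/= Uu' Ss' _].
  under eq_bigr do rewrite mulrC.
  rewrite -decomp /v /=; congr ((_ : bool)%:R); apply/eqP/eqP => [[_ -> ->]|].
    exact: telescope3.
  by move=> /(stpp_zero STU Ss Tt Tt Uu Uu' Ss')[_ -> -> _ ->].
exists phi1, phi2, phi3; split=> // i s t u Ss Tt Uu; rewrite leqNgt; apply/negP => ltD.
have [|x [[x1 lx] kx]] := H1 (i, (s, t)).
  by rewrite inE /= Ss Tt; apply/finset.set0Pn; exists u.
have [|y [[y1 ly] ky]] := H2 (i, (t, u)).
  by rewrite inE /= Tt Uu; apply/finset.set0Pn; exists s.
have [|z [[z1 lz] kz]] := H3 (i, (u, s)).
  by rewrite inE /= Uu Ss; apply/finset.set0Pn; exists t.
suff : 1 = 0 :> F by apply/eqP; rewrite oner_eq0.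
transitivity ((\sum_j (j == (i, (s, t)))%:R) * (\sum_j (j == (i, (t, u)))%:R) *
  (\sum_j (j == (i, (u, s)))%:R) : F); first by rewrite !sum_pred1 !mulr1.
transitivity (\sum_(o | ok o) (\sum_j x j * f (pf o) (v j)) *
  (\sum_j y j * g (pg o) (v j)) * (\sum_j z j * h (ph o) (v j))); last first.
  rewrite big1 // => o /degD le.
  have [/kx->|le1] := ltnP (deg (pf o)) (deg (phi1 (i, (s, t)))); first by rewrite !mul0r.
  have [/ky->|le2] := ltnP (deg (pg o)) (deg (phi2 (i, (t, u)))); first by rewrite mulr0 mul0r.
  have [/kz->|le3] := ltnP (deg (ph o)) (deg (phi3 (i, (u, s)))); first by rewrite mulr0.
  by move: ltD; rewrite ltnNge (leq_trans _ le) // !leq_add.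
under [RHS]eq_bigr do rewrite sum_prod3.
rewrite sum_prod3 [RHS]exchange_big; apply: eq_bigr => j1 _.
rewrite [RHS]exchange_big; apply: eq_bigr => j2 _.
rewrite [RHS]exchange_big; apply: eq_bigr => j3 _ /=.
transitivity (x j1 * y j2 * z j3 * (v j1 + v j2 + v j3 == 0)%:R); last first.
  by rewrite decomp mulr_sumr; apply: eq_bigr => o _; ring.
have [/and3P[/eqP-> /eqP-> /eqP->]|ne] :=
  boolP [&& j1 == (i, (s, t)), j2 == (i, (t, u)) & j3 == (i, (u, s))].
  by rewrite x1 y1 z1 /v /= telescope3 !eqxx !mulr1.
transitivity (0 : F).
  by move: ne; do 3!case: eqP => //= _; rewrite ?mulr0 ?mul0r.
apply/esym/eqP; apply: contraNT ne; rewrite !mulf_eq0 !negb_or => /andP[/andP[/andP[xj yj] zj]].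
have [Pj1 le1] := lx _ xj; have [Pj2 le2] := ly _ yj; have [Pj3 le3] := lz _ zj.
case: j1 j2 j3 Pj1 Pj2 Pj3 le1 le2 le3 {xj yj zj} => [i1 [s1 t1]] [i2 [t2 u2]] [i3 [u3 s3]].
rewrite !inE /v /= => /and3P[Ss1 Tt1 _] /and3P[Tt2 Uu2 _] /and3P[Uu3 Ss3 _] le1 le2 le3.
case: (_ =P (0 : G)) => [/(stpp_zero STU Ss1 Tt1 Tt2 Uu2 Uu3 Ss3)[ij jl es et eu] _|_]; last by rewrite eqxx.
subst.
by have [-> -> -> ->] := antichain le1 le2 le3; rewrite !eqxx.
Qed.

End DegreeBound.

(** * A binomial indicator of divisibility in characteristic [p] *)

Section BinomialIndicator.
Variables (p e : nat).
Hypothesis p_pr : prime p.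

(** [p ^ e] divides [i * 'C(p ^ e, i)], so a binomial prime to [p] would force [p ^ e] to divide
    [i]. *)
Lemma prime_power_dvd_bin i : (0 < i < p ^ e)%N -> (p %| 'C(p ^ e, i))%N.
Proof.
case: i => // i /andP[_ ilt]; apply: contraLR ilt => ndvd; rewrite -leqNgt.
have : (p ^ e %| i.+1 * 'C(p ^ e, i.+1))%N.
  by rewrite -mul_bin_diag dvdn_mulr.
by rewrite Gauss_dvdl ?coprimeXl ?prime_coprime // => /dvdn_leq; apply.
Qed.

(** In Vandermonde's convolution all terms but the first have a factor ['C(p ^ e, i)] with
    [0 < i < p ^ e], which is 0 modulo [p]. *)
Lemma bin_period x j : (j < p ^ e)%N -> 'C(p ^ e + x, j)%:R = 'C(x, j)%:R :> 'F_p.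
Proof.
move=> jq; rewrite -binomial.Vandermonde big_ord_recl bin0 mul1n subn0 natrD natr_sum.
rewrite big1 ?addr0 // => i _; apply/eqP; rewrite natrM mulf_eq0; apply/orP; left.
rewrite -(dvdn_pcharf (pchar_Fp p_pr)) prime_power_dvd_bin //=.
by rewrite /bump /= add1n; apply: leq_ltn_trans jq.
Qed.

Lemma bin_period_mul n x j : (j < p ^ e)%N -> 'C(n * p ^ e + x, j)%:R = 'C(x, j)%:R :> 'F_p.
Proof. by move=> jq; elim: n => // n IH; rewrite mulSn -addnA bin_period. Qed.

(** Only the residue of [x] modulo [q.+1] matters. A residue [r.+1] gives [r.+1 + q = p ^ e + r]
    with [r < q], hence ['C(r, q) = 0]. *)
Lemma bin_indicator q x : q.+1 = (p ^ e)%N -> 'C(x + q, q)%:R = (q.+1 %| x)%:R :> 'F_p.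
Proof.
move=> qE; have qlt : (q < p ^ e)%N by rewrite -qE.
rewrite {1}(divn_eq x q.+1) -addnA {2}qE bin_period_mul // /dvdn.
case: (x %% q.+1)%N (ltn_pmod x (ltn0Sn q)) => [|r]; first by rewrite binn.
by rewrite !ltnS addSnnS qE addnC => rq; rewrite bin_period // bin_small.
Qed.

End BinomialIndicator.

Lemma Vandermonde_ord n m y z : (m <= n)%N ->
  (\sum_(i < n.+1) \sum_(k < n.+1 | i + k == m) 'C(y, i) * 'C(z, k) = 'C(y + z, m))%N.
Proof.
move=> mn; rewrite -binomial.Vandermonde (big_ord_widen n.+1 (fun i => 'C(y, i) * 'C(z, m - i))%N) //.
rewrite [RHS]big_mkcond; apply: eq_bigr => i _; rewrite ltnS.
case: leqP => im.
  have lt : (m - i < n.+1)%N by rewrite ltnS (leq_trans (leq_subr _ _)).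
  rewrite (big_pred1 (Ordinal lt)) // => k; apply/eqP/eqP => [h|->/=]; last by lia.
  by apply: val_inj => /=; lia.
by rewrite big1 // => k /eqP; lia.
Qed.

Lemma Vandermonde3 n x y z :
  (\sum_(o : 'I_n.+1 * 'I_n.+1 * 'I_n.+1 | o.1.1 + o.1.2 + o.2 == n)
     'C(x, o.1.1) * 'C(y, o.1.2) * 'C(z, o.2) = 'C(x + y + z, n))%N.
Proof.
rewrite -addnA -binomial.Vandermonde.
rewrite -(pair_big_dep xpredT (fun (a : 'I_n.+1 * 'I_n.+1) (c : 'I_n.+1) => a.1 + a.2 + c == n)
  (fun a c => 'C(x, a.1) * 'C(y, a.2) * 'C(z, c)))%N /=.
rewrite -(pair_big_dep xpredT (fun _ _ => true) (fun a b : 'I_n.+1 =>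
  \sum_(c < n.+1 | a + b + c == n) 'C(x, a) * 'C(y, b) * 'C(z, c)))%N /=.
apply: eq_bigr => a _; have an : (a <= n)%N by rewrite -ltnS.
rewrite -(Vandermonde_ord y z (leq_subr a n)) big_distrr /=; apply: eq_bigr => b _.
rewrite big_distrr /=; apply: eq_big => [c|c _]; last by rewrite mulnA.
by apply/eqP/eqP; lia.
Qed.

(** * Binomial monomials for the zero-sum indicator *)

Section Monomials.
Variables (p e q L : nat).
Hypotheses (p_pr : prime p) (qE : q.+1 = (p ^ e)%N).
Notation G := ('rV['I_q.+1]_L).
Notation exps := {ffun 'I_L -> 'I_q.+1}.

(* The shift [c] is [q] in the third variable, so that the sum of the three arguments of the
   binomials is [x + y + z + q]; here the modulus is [q.+1]. *)
Definition bin_mono (c : nat) (a : exps) (x : G) : 'F_p := \prod_l 'C(x 0 l + c, a l)%:R.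
Definition exps_deg (a : exps) : nat := (\sum_l a l)%N.
Definition top_triples : {pred {ffun 'I_L -> 'I_q.+1 * 'I_q.+1 * 'I_q.+1}} :=
  ffun_on [pred o : 'I_q.+1 * 'I_q.+1 * 'I_q.+1 | o.1.1 + o.1.2 + o.2 == q]%N.

(** In each coordinate the indicator is ['C(x + y + z + q, q)], which [Vandermonde3] splits;
    expanding the product over coordinates gives one term for each choice of a triple per
    coordinate. *)
Lemma sum0_decomp (x y z : G) : (x + y + z == 0)%:R =
  \sum_(o | o \in top_triples) bin_mono 0 [ffun l => (o l).1.1] x *
    bin_mono 0 [ffun l => (o l).1.2] y * bin_mono q [ffun l => (o l).2] z :> 'F_p.
Proof.
transitivity (\prod_l (x 0 l + y 0 l + z 0 l == 0)%:R : 'F_p).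
  have [e0|ne] := eqVneq (x + y + z) 0.
    rewrite big1 // => l _; move/rowP/(_ l): e0; rewrite !mxE => ->.
    by rewrite eqxx.
  have [l nl] : exists l, x 0 l + y 0 l + z 0 l != 0.
    apply/existsP; apply: contraNT ne => /existsPn H; apply/eqP/rowP => l.
    by rewrite !mxE; apply/eqP; have := H l; rewrite negbK.
  by rewrite (bigD1 l) //= (negPf nl) mul0r.
transitivity (\prod_l \sum_(o in [pred o : 'I_q.+1 * 'I_q.+1 * 'I_q.+1 | o.1.1 + o.1.2 + o.2 == q]%N)
   ('C(x 0 l, o.1.1) * 'C(y 0 l, o.1.2) * 'C(z 0 l + q, o.2))%:R : 'F_p).
  apply: eq_bigr => l _; rewrite -natr_sum Vandermonde3 ord_sum3_eq0.
  by rewrite -(bin_indicator p_pr _ qE) addnA.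
rewrite bigA_distr_big; apply: eq_bigr => o _.
rewrite -!big_split /=; apply: eq_bigr => l _.
by rewrite !ffunE !addn0 !natrM.
Qed.

Lemma top_triples_deg (o : {ffun 'I_L -> 'I_q.+1 * 'I_q.+1 * 'I_q.+1}) :
  o \in top_triples ->
  (exps_deg [ffun l => (o l).1.1] + exps_deg [ffun l => (o l).1.2] +
   exps_deg [ffun l => (o l).2] <= q * L)%N.
Proof.
move=> /ffun_onP H; rewrite -!big_split /= (eq_bigr (fun=> q)) => [|l _].
  by rewrite sum_nat_const card_ord mulnC.
by rewrite !ffunE; apply/eqP; exact: H.
Qed.

Lemma stpp_exps_degree (k : nat) (S T U : 'I_k -> {set G}) : STPP S T U ->
  exists phi1 phi2 phi3 : 'I_k * (G * G) -> exps,
  [/\ {in block S T U &, injective phi1}, {in block T U S &, injective phi2},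
      {in block U S T &, injective phi3} &
      forall i s t u, s \in S i -> t \in T i -> u \in U i ->
        (exps_deg (phi1 (i, (s, t))) + exps_deg (phi2 (i, (t, u))) +
         exps_deg (phi3 (i, (u, s))) <= q * L)%N].
Proof.
by move=> STU; apply: (stpp_degree sum0_decomp top_triples_deg STU [ffun=> ord0]).
Qed.

End Monomials.

(** * AM-GM on a single block *)

Section BlockInequality.
Variable R : realType.

Lemma amgm3 (x y z : R) : 0 <= x -> 0 <= y -> 0 <= z ->
  x * y * z <= ((x + y + z) / 3) ^+ 3.
Proof.
move=> x0 y0 z0; rewrite -subr_ge0.
(* The difference is a combination of squares with nonnegative coefficients. *)
have -> : ((x + y + z) / 3) ^+ 3 - x * y * z =
  ((x + y + z) / 2 * ((x - y) ^+ 2 + (y - z) ^+ 2 + (z - x) ^+ 2) +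
   3 * (x * (y - z) ^+ 2 + y * (z - x) ^+ 2 + z * (x - y) ^+ 2)) / 27 by field.
by repeat first [assumption | exact: ler0n | exact: sqr_ge0 | apply: divr_ge0
  | apply: addr_ge0 | apply: mulr_ge0].
Qed.

Lemma powR23_amgm (p x y z : R) : 0 <= p -> 0 <= x -> 0 <= y -> 0 <= z ->
  p ^+ 2 <= x * y * z -> p `^ (2 / 3) <= (x + y + z) / 3.
Proof.
move=> p0 x0 y0 z0 h; have m0 : 0 <= (x + y + z) / 3 by rewrite divr_ge0 ?addr_ge0.
have := le_trans h (amgm3 x0 y0 z0); rewrite -!powR_mulrn // => {}h.
have := @ge0_ler_powR R 3^-1 _ _ _ _ _ h; rewrite !nnegrE invr_ge0 ?powR_ge0 => H.
have {H} := H (ler0n _ _) isT isT; rewrite -!powRrM divff ?powRr1 //.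
Qed.

(** For each [(s, t, u)], AM-GM is applied to [ab w1], [bc w2], [ca w3] with [a], [b], [c] the
    cardinals; their product is at least [(abc)^2]. Averaging over all triples, these factors match
    the multiplicity of each pair. *)
Lemma block_amgm (G : finType) (A B C : {set G}) (w1 w2 w3 : G * G -> R) :
  A != finset.set0 -> B != finset.set0 -> C != finset.set0 ->
  (forall x, 0 <= w1 x) -> (forall x, 0 <= w2 x) -> (forall x, 0 <= w3 x) ->
  (forall s t u, s \in A -> t \in B -> u \in C -> 1 <= w1 (s, t) * w2 (t, u) * w3 (u, s)) ->
  (#|A| * #|B| * #|C|)%:R `^ (2 / 3) <=
    (\sum_(s in A) \sum_(t in B) w1 (s, t) + \sum_(t in B) \sum_(u in C) w2 (t, u) +
     \sum_(u in C) \sum_(s in A) w3 (u, s)) / 3.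
Proof.
rewrite -!card_gt0 => A0 B0 C0 w10 w20 w30 w123.
set a := #|A| in A0 *; set b := #|B| in B0 *; set c := #|C| in C0 *.
set P := \sum_(s in A) _; set Q := \sum_(t in B) \sum_(u in C) _; set S := \sum_(u in C) _.
set r := _ `^ _.
have abc0 : 0 < (a * b * c)%:R :> R by rewrite ltr0n !muln_gt0 A0 B0 C0.
rewrite -(ler_pM2l abc0).
have -> : (a * b * c)%:R * r = \sum_(s in A) \sum_(t in B) \sum_(u in C) r.
  by rewrite !sumr_const -/a -/b -/c -!mulrnA mulr_natl; congr (_ *+ _); lia.
have -> : (a * b * c)%:R * ((P + Q + S) / 3) = \sum_(s in A) \sum_(t in B) \sum_(u in C)
    ((a * b)%:R * w1 (s, t) + (b * c)%:R * w2 (t, u) + (c * a)%:R * w3 (u, s)) / 3.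
  under [RHS]eq_bigr do under eq_bigr do rewrite -mulr_suml !big_split /=.
  under [RHS]eq_bigr do rewrite -mulr_suml !big_split /=.
  rewrite -mulr_suml !big_split /= mulrA; congr (_ / 3); rewrite !mulrDr.
  congr (_ + _ + _).
  - rewrite mulr_sumr; apply: eq_bigr => s _; rewrite mulr_sumr; apply: eq_bigr => t _.
    by rewrite sumr_const -/c -[RHS]mulr_natl mulrA -natrM mulnC.
  - rewrite sumr_const -/a -[RHS]mulr_natl /Q mulr_sumr [RHS]mulr_sumr; apply: eq_bigr => t _.
    by rewrite -mulr_sumr mulrA -natrM mulnA.
  - rewrite /S exchange_big /= mulr_sumr; apply: eq_bigr => s _.
    by rewrite sumr_const -/b -[RHS]mulr_natl -mulr_sumr mulrA -natrM; congr (_%:R * _); lia.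
apply: ler_sum => s As; apply: ler_sum => t Bt; apply: ler_sum => u Cu.
apply: powR23_amgm; rewrite ?mulr_ge0 ?ler0n //.
have -> : (a * b)%:R * w1 (s, t) * ((b * c)%:R * w2 (t, u)) * ((c * a)%:R * w3 (u, s)) =
  (a * b * c)%:R ^+ 2 * (w1 (s, t) * w2 (t, u) * w3 (u, s)) by rewrite !natrM; ring.
by rewrite ler_peMr ?sqr_ge0 // w123.
Qed.

End BlockInequality.

(** * Exponential weights on exponent vectors *)

Section Weights.
Variables (R : realType) (q L : nat).
Hypothesis q0 : (0 < q)%N.
Notation exps := {ffun 'I_L -> 'I_q.+1}.

(** The shift [1 / 3] is chosen so that three exponent vectors of total degree [q * L] have weights
    with product 1. *)
Definition weight (a : exps) : R := \prod_l expR ((1 / 3 - (a l)%:R / q%:R) * ln 2).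

Lemma weight_ge0 a : 0 <= weight a.
Proof. by apply: prodr_ge0 => l _; apply: expR_ge0. Qed.

Lemma weightE a : weight a = expR ((L%:R / 3 - (exps_deg a)%:R / q%:R) * ln 2).
Proof.
rewrite /weight -expR_sum; congr expR; rewrite -mulr_suml; congr (_ * _).
rewrite sumrB sumr_const card_ord -mulr_suml -natr_sum; congr (_ - _).
by rewrite mul1r -[LHS]mulr_natl.
Qed.

Lemma weight_prod_ge1 a b c : (exps_deg a + exps_deg b + exps_deg c <= q * L)%N ->
  1 <= weight a * weight b * weight c.
Proof.
move=> le; rewrite !weightE -!expRD -[leLHS]expR0 ler_expR -!mulrDl.
rewrite mulr_ge0 ?ln_ge0 ?ler1n //.
have -> : L%:R / 3 - (exps_deg a)%:R / q%:R + (L%:R / 3 - (exps_deg b)%:R / q%:R) +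
  (L%:R / 3 - (exps_deg c)%:R / q%:R) =
  ((q * L)%:R - (exps_deg a + exps_deg b + exps_deg c)%:R) / q%:R :> R.
  by rewrite !natrD natrM; field; rewrite pnatr_eq0 -lt0n.
by rewrite divr_ge0 // subr_ge0 ler_nat.
Qed.

(** Pairing [i] with [q - i] bounds the mean by [3/4 * 2 ^ (1/3)], which is below [95/100]. *)
Lemma weight1_sum_le :
  \sum_(i < q.+1) expR ((1 / 3 - i%:R / q%:R) * ln 2) <= 95 / 100 * q.+1%:R :> R.
Proof.
pose w (i : 'I_q.+1) : R := expR ((1 / 3 - i%:R / q%:R) * ln 2).
rewrite -[leLHS]/(\sum_i w i).
have q0R : 0 < q%:R :> R by rewrite ltr0n.
pose t : R := expR (ln 2 / 3).
have t3 : t ^+ 3 = 2 by rewrite -expRM_natl mulrC divfK // lnK // posrE.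
have t0 : 0 < t by apply: expR_gt0.
have t127 : t <= 127 / 100.
  rewrite -(@ler_pXn2r _ 3) ?nnegrE ?(ltW t0) ?divr_ge0 // t3; lra.
(* With [v = 2 ^ (- i / q)] this is [v + 1 / (2 v) <= 3 / 2], true on [[1 / 2, 1]]. *)
have pair i : w i + w (rev_ord i) <= 3 / 2 * t.
  pose v : R := expR (- (i%:R / q%:R) * ln 2).
  have iq : i%:R / q%:R <= 1 :> R by rewrite ler_pdivrMr // mul1r ler_nat -ltnS.
  have iq0 : 0 <= i%:R / q%:R :> R by rewrite divr_ge0.
  have l2 : 0 <= ln 2 :> R by rewrite ln_ge0 // ler1n.
  have v1 : v <= 1 by rewrite -expR0 ler_expR; nra.
  have v2 : 1 / 2 <= v.
    rewrite -[leLHS]lnK ?posrE ?divr_gt0 // ler_expR mul1r lnV ?posrE //; nra.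
  have v0 : 0 < v by apply: expR_gt0.
  have -> : w i = t * v by rewrite -expRD; congr expR; ring.
  have -> : w (rev_ord i) = t * (v^-1 / 2).
    have -> : 2^-1 = expR (- ln 2) :> R by rewrite expRN lnK // posrE.
    rewrite -expRN -!expRD; congr expR.
    rewrite /= subSS natrB -1?ltnS //; field; exact: lt0r_neq0.
  have vK : v^-1 / 2 * v = 1 / 2 by field; exact: lt0r_neq0.
  rewrite -mulrDr [leRHS]mulrC ler_pM2l // -(ler_pM2r v0) mulrDl vK; nra.
have : \sum_i (w i + w (rev_ord i)) <= \sum_(i < q.+1) 3 / 2 * t by apply: ler_sum.
rewrite big_split /= sumr_const card_ord.
have -> : \sum_i w (rev_ord i) = \sum_i w i by rewrite [RHS](reindex_inj rev_ord_inj).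
rewrite -[leRHS]mulr_natl; have : 0 <= q.+1%:R :> R by [].
move: (\sum_i w i) (q.+1%:R : R) => s r r0; nra.
Qed.

Lemma weight_sum_le : \sum_a weight a <= (95 / 100) ^+ L * (q.+1 ^ L)%:R.
Proof.
rewrite /weight -(bigA_distr_bigA (fun _ (j : 'I_q.+1) => expR ((1 / 3 - j%:R / q%:R) * ln 2))).
rewrite prodr_const card_ord natrX -exprMn lerXn2r ?nnegrE ?mulr_ge0 ?divr_ge0 //.
  by apply: sumr_ge0 => i _; apply: expR_ge0.
exact: weight1_sum_le.
Qed.

End Weights.

Lemma sum_inj_le (R : numDomainType) (E X : finType) (w : E -> R) (B : {set X}) (phi : X -> E) :
  (forall a, 0 <= w a) -> {in B &, injective phi} -> \sum_(x in B) w (phi x) <= \sum_a w a.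
Proof.
move=> w0 inj; rewrite -(big_imset w inj) /= big_mkcond /=; apply: ler_sum => a _.
by case: ifP.
Qed.

(** * The bound on the sum of [2/3] powers *)

Section STPPBound.
Variables (R : realType) (p e q L k : nat).
Hypotheses (p_pr : prime p) (qE : q.+1 = (p ^ e)%N) (q0 : (0 < q)%N).
Notation G := ('rV['I_q.+1]_L).
Variables (S T U : 'I_k -> {set G}).
Hypothesis STU : STPP S T U.

(** Summing [block_amgm] over the blocks leaves a third of three sums of weights; each runs over
    distinct monomials, so it is at most the total weight. *)
Lemma stpp_bound :
  \sum_(i < k) (#|S i| * #|T i| * #|U i|)%:R `^ (2 / 3) <=
  (95 / 100) ^+ L * (q.+1 ^ L)%:R :> R.
Proof.
have [phi1 [phi2 [phi3 [inj1 inj2 inj3 degD]]]] := stpp_exps_degree p_pr qE STU.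
pose bs (A B C : 'I_k -> {set G}) (phi : 'I_k * (G * G) -> {ffun 'I_L -> 'I_q.+1}) i : R :=
  \sum_(x | (i, x) \in block A B C) weight R (phi (i, x)).
have bs_le A B C phi : {in block A B C &, injective phi} ->
    \sum_i bs A B C phi i <= (95 / 100) ^+ L * (q.+1 ^ L)%:R.
  move=> inj; apply: le_trans (weight_sum_le R L q0).
  apply: le_trans (sum_inj_le (weight_ge0 R (L := L)) inj).
  rewrite /bs (pair_big_dep xpredT (fun i x => (i, x) \in block A B C)
    (fun i x => weight R (phi (i, x)))) /=.
  by rewrite le_eqVlt; apply/orP; left; apply/eqP; apply: eq_big => [[i x]|[i x]].
have bsE (A B C : 'I_k -> {set G}) phi i : C i != finset.set0 ->
    bs A B C phi i = \sum_(s in A i) \sum_(t in B i) weight R (phi (i, (s, t))).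
  move=> C0; rewrite pair_big_dep /=; apply: eq_big => [[s t]|[s t] //].
  by rewrite inE C0 /= andbT.
have blk i : (#|S i| * #|T i| * #|U i|)%:R `^ (2 / 3) <=
    (bs S T U phi1 i + bs T U S phi2 i + bs U S T phi3 i) / 3.
  have [/and3P[S0 T0 U0]|] := boolP [&& S i != finset.set0, T i != finset.set0 & U i != finset.set0].
    rewrite !bsE //; apply: (block_amgm (w1 := fun x => weight R (phi1 (i, x)))
      (w2 := fun x => weight R (phi2 (i, x))) (w3 := fun x => weight R (phi3 (i, x)))) => //;
      try by move=> x; apply: weight_ge0.
    by move=> s t u Ss Tt Uu; apply: weight_prod_ge1 => //; apply: degD.
  (* A block with an empty set contributes 0 to the left side. *)
  move=> H; have -> : (#|S i| * #|T i| * #|U i| = 0)%N.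
    apply/eqP; rewrite !muln_eq0 !cards_eq0; move: H.
    by rewrite !negb_and !negbK orbA.
  rewrite powR0; last by rewrite mulf_neq0 // invr_eq0.
  by rewrite divr_ge0 // !addr_ge0 // sumr_ge0 // => x _; apply: weight_ge0.
apply: le_trans (ler_sum _ (fun i _ => blk i)) _.
rewrite -mulr_suml !big_split /=.
have := bs_le _ _ _ _ inj1; have := bs_le _ _ _ _ inj2; have := bs_le _ _ _ _ inj3.
lra.
Qed.

End STPPBound.

(** * Large blocks dominate *)

Section Threshold.
Variable R : realType.

(* The two terms come from the cases [x <= B ^ 3] and [x > B ^ 3]. *)
Lemma powR_threshold (x B d : R) : 0 <= x -> 1 <= B -> 0 < d -> d <= 1 / 2 ->
  x `^ ((2 + d) / 3) <= B `^ d * x `^ (2 / 3) + x / B `^ (1 / 2).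
Proof.
move=> x0 B1 d0 d2; have B0 : 0 < B by apply: lt_le_trans B1.
have [->|xn0] := eqVneq x 0.
  by rewrite !powR0 ?mulr0 ?mul0r ?addr0 ?gt_eqF // divr_gt0 // addr_gt0.
have {xn0} x0' : 0 < x by rewrite lt0r xn0.
have b0 : 0 <= ln B by rewrite ln_ge0.
rewrite /powR !gt_eqF // -expRN -[X in _ + X * _](lnK x0') -!expRD.
have [le|lt] := leP (ln x / 3) (ln B).
  apply: (@le_trans _ _ (expR (d * ln B + 2 / 3 * ln x))); last by rewrite lerDl expR_ge0.
  by rewrite ler_expR; nra.
apply: (@le_trans _ _ (expR (ln x - 1 / 2 * ln B))); last by rewrite lerDr expR_ge0.
by rewrite ler_expR; nra.
Qed.

Lemma large_sum (k L : nat) (x : 'I_k -> R) (N A d : R) : (0 < L)%N -> 0 <= N ->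
  (forall i, 0 <= x i) -> 400 <= A -> d = ln (102 / 100) / ln (A ^+ 2) ->
  \sum_i x i `^ (2 / 3) <= (95 / 100) ^+ L * N ->
  N < \sum_i x i `^ ((2 + d) / 3) -> 10 ^+ L * N <= \sum_i x i.
Proof.
move=> L0 N0 x0 A400 dE bound big.
have A1 : 1 < A by lra.
have A0 : 0 < A by lra.
have lA : 0 < ln A by rewrite ln_gt0.
have l2 : ln (A ^+ 2) = 2 * ln A by rewrite lnXn // mulr2n; ring.
have d0 : 0 < d.
  rewrite dE l2; apply: divr_gt0; last by apply: mulr_gt0.
  by apply: ln_gt0; lra.
have dA : d * ln A = ln (102 / 100) / 2 by rewrite dE l2; field; exact: lt0r_neq0.
have lA2 : ln (102 / 100) <= ln A by rewrite ler_ln ?posrE //; lra.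
have d2 : d <= 1 / 2 by rewrite -(ler_pM2r lA) dA; lra.
(* For this [B] the value of [d] gives [B ^ d = 1.02 ^ L] and [B ^ (1/2) = A ^ L]; as
   [1.02 * 0.95 = 0.969], the first term of [powR_threshold] sums to at most [0.969 ^ L * N]. *)
pose B : R := (A ^+ 2) ^+ L.
have B1 : 1 <= B by apply/exprn_ege1/exprn_ege1/ltW.
have Bd : B `^ d = (102 / 100) ^+ L.
  rewrite /B -powR_mulrn ?exprn_ge0 ?ltW // -powRrM mulrC powRrM powR_mulrn ?powR_ge0 //.
  congr (_ ^+ L); rewrite /powR gt_eqF ?exprn_gt0 // l2 mulrCA dA mulrC divfK // lnK // posrE; lra.
have B2 : B `^ (1 / 2) = A ^+ L.
  rewrite /B -powR_mulrn ?exprn_ge0 ?ltW // -powRrM mulrC powRrM powR_mulrn ?powR_ge0 //.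
  by congr (_ ^+ L); rewrite -powR_mulrn ?ltW // -powRrM mulrC divfK // powRr1 // ltW.
have : \sum_i x i `^ ((2 + d) / 3) <= (969 / 1000) ^+ L * N + (\sum_i x i) / A ^+ L.
  apply: le_trans (ler_sum _ (fun i _ => powR_threshold (x0 i) B1 d0 d2)) _.
  rewrite big_split /= -mulr_sumr -mulr_suml Bd B2 lerD2r.
  have -> : (969 / 1000) ^+ L = (102 / 100) ^+ L * (95 / 100) ^+ L :> R.
    by rewrite -exprMn; congr (_ ^+ L); lra.
  by rewrite -mulrA ler_wpM2l // exprn_ge0 // divr_ge0.
move=> /(lt_le_trans big); rewrite -ltrBlDl => lt.
(* Since [L > 0], more than [0.031 * N] is left for the second term. *)
have le969 : (969 / 1000) ^+ L <= 969 / 1000 :> R.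
  have leX (r : R) : 0 <= r -> r <= 1 -> r ^+ L <= r.
    by move=> r0 r1; rewrite -[leRHS]expr1 ler_wiXn2l.
  by apply: leX; lra.
have : (31 / 1000) * N < (\sum_i x i) / A ^+ L.
  by apply: le_lt_trans lt; rewrite -subr_ge0; nra.
have AL : 0 < A ^+ L by rewrite exprn_gt0.
rewrite ltr_pdivlMr // => /ltW; apply: le_trans.
have -> : A ^+ L = 10 ^+ L * (A / 10) ^+ L by rewrite -exprMn; congr (_ ^+ L); lra.
(* [A / 10 >= 40] absorbs the factor [0.031], because [0.031 * 40 > 1]. *)
have h40 : A / 10 <= (A / 10) ^+ L.
  by rewrite -[leLHS]expr1 ler_eXn2l //; lra.
have : 0 <= 10 ^+ L * N by rewrite mulr_ge0 // exprn_ge0.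
move: (10 ^+ L : R) ((A / 10) ^+ L) h40 => t h h40 tN.
have -> : 31 / 1000 * N * (t * h) = t * N * (31 / 1000 * h) by ring.
nra.
Qed.

End Threshold.

(** * Growth exponent for all [n] *)

Section Growth.
Variables (R : realType) (q L : nat).
Hypothesis L0 : (0 < L)%N.

(** For the largest [m] with [b ^ (L * m) <= n], the [m]-th power and its embedding give [val_Z n >=
    (10 * q.+1 / 3) ^ (L * m) = g ^ (L * m)]. As [g = b ^ (1 + c)] and [n < b ^ (L * (m + 1))], only
    the constant factor [g ^ L] is lost. *)
Lemma val_growth : rigid_sums 'rV['I_q.+1]_L (10 ^ L * q.+1 ^ L) ->
  exists c C : R, 0 < c /\ 0 < C /\
    forall n : nat, (0 < n)%N -> C * n%:R `^ (1 + c) <= (val_Z n)%:R.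
Proof.
move=> rs; pose b : R := (3 * q.+1)%:R; pose g : R := 10 / 9 * b.
have b1 : 1 < b by rewrite ltr1n; lia.
have b0 : 0 < b by apply: lt_trans b1.
have lb : 0 < ln b by rewrite ln_gt0.
have g0 : 0 < g by rewrite mulr_gt0 // divr_gt0.
pose c := ln (10 / 9) / ln b.
have c0 : 0 < c by rewrite divr_gt0 // ln_gt0; lra.
have bc : b `^ (1 + c) = g.
  rewrite powRD; last by rewrite (gt_eqF b0) implybT.
  rewrite powRr1 ?ltW // mulrC; congr (_ * _).
  by rewrite /powR gt_eqF // divfK ?gt_eqF // lnK // posrE divr_gt0.
exists c, ((g ^+ L)^-1); split=> //; split; first by rewrite invr_gt0 exprn_gt0.
move=> n n0; have n01 : (1 < (3 * q.+1) ^ L)%N.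
  by rewrite -(exp1n L) ltn_exp2r //; lia.
pose m := trunc_log ((3 * q.+1) ^ L) n.
have /andP[lo hi] := trunc_log_bounds n01 n0.
rewrite -/m -!expnM in lo hi.
have vg : g ^+ (L * m) <= (val_Z n)%:R.
  case: n n0 @m lo hi => // n _ m lo _.
  have := rigid_sums_val_Z (n := n) _ (rigid_sums_pow m rs).
  rewrite card_prod !card_ord [(m * L)%N]mulnC => /(_ lo).
  rewrite -expnMn -expnM -(ler_nat R) natrM !natrX natrM => H.
  have -> : g = 10 * q.+1%:R / 3 by rewrite /g /b natrM; field.
  by rewrite expr_div_n ler_pdivrMr ?exprn_gt0 // [leRHS]mulrC.
apply: le_trans vg; rewrite mulrC ler_pdivrMr ?exprn_gt0 // -exprD addnC -mulnS -bc.
rewrite -powR_mulrn ?powR_ge0 // -powRrM mulrC powRrM powR_mulrn ?(ltW b0) //.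
apply: ge0_ler_powR; rewrite ?nnegrE //.
- by rewrite addr_ge0 // ltW.
- by rewrite exprn_ge0 // ltW.
- by rewrite -natrX ler_nat ltnW.
Qed.

End Growth.

Theorem theorem4p4 (R : realType) :
  achieves_omega2 R prime_power_family ->
  exists c C : R, 0 < c /\ 0 < C /\
    forall n : nat, (0 < n)%N -> C * n%:R `^ (1 + c) <= (val_Z n)%:R.
Proof.
(* This delta is the [d] of [large_sum] at [A = 400]; it is fixed before the group is known. *)
have d0 : 0 < ln (102 / 100) / ln (400 ^+ 2) :> R.
  by rewrite divr_gt0 // ln_gt0 ?exprn_egt1 //; lra.
move=> /(_ _ d0)[G [[q0 L [p [e [p_pr e0 qE]]] L0] [k [S [T [U [STU big]]]]]]].
have q01 : (1 < q0)%N by rewrite qE -(exp1n e) ltn_exp2r ?prime_gt1.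
(* ['Z_q0] unfolds to ['I_(Zp_trunc q0).+2], so the [q] of the earlier lemmas is
   [(Zp_trunc q0).+1]. *)
have qE' : (Zp_trunc q0).+2 = (p ^ e)%N by rewrite Zp_cast.
apply: (@val_growth R (Zp_trunc q0).+1 L L0).
apply: rigid_sumsW (stpp_rigid_sums STU); rewrite -(ler_nat R) natr_sum natrM natrX.
apply: (large_sum (A := 400) L0 _ _ _ erefl) => //.
  exact: (stpp_bound R p_pr qE' isT STU).
by move: big; rewrite card_mx !card_ord mul1n.
Qed.
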